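(* Let $A=\{0,1\}$ and let $(A^{\mathbb{Z}},F)$ be a one-dimensional cellular automaton of radius $r$. Then $(A^{\mathbb{Z}},F)$ is chain-transitive if and only if it is regional controllable for every $n$. Likewise, $(A^{\mathbb{Z}},F)$ is chain-mixing if and only if it is regional controllable for every $n$.
   Context: A cellular automaton of radius $r\ge 1$ is given by a local rule $f:A^{2r+1}\to A$ and $F(s)_i=f(s_{i-r},\dots,s_{i+r})$. For a finite word $z\in A^{n+2r}$, $F(z)\in A^n$ denotes the word obtained by applying $f$ at the $n$ central positions. $A^{\mathbb{Z}}$ carries the metric $d(s,e)=2^{-\min\{|i| : s_i\neq e_i\}}$ for $s\ne e$, and $d(s,s)=0$. Chains: an $\varepsilon$-chain of length $n>0$ from $x$ to $y$ is a sequence $x=x_0,x_1,\dots,x_n=y$ with $d(F(x_i),x_{i+1})<\varepsilon$ for all $0\le i\le n-1$. The system is chain-transitive if for all $x,y\in A^{\mathbb{Z}}$ and $\varepsilon>0$ there is an $\varepsilon$-chain from $x$ to $y$. It is chain-mixing if for all $x,y$ and $\varepsilon>0$ there is $N>0$ such that for all $n\ge N$ there is an $\varepsilon$-chain $x=x_0,\dots,x_n=y$. Regional controllability: let $\omega=\{c_1,\dots,c_n\}$ be a region of $n\geq 1$ consecutive cells, whose configurations are identified with words in $A^n$. A word $u\in A^n$ is reachable from $w\in A^n$ in one step if there is a boundary control $(x,y)\in (A^r)^2$ with $F(xwy)=u$, where $xwy$ is the concatenation. A word $u$ is reachable from $w$ at time $T$ if there are words $w=w^0,w^1,\dots,w^T=u$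 in $A^n$ with each $w^{i+1}$ reachable from $w^i$ in one step. The CA is regional controllable on $\omega$ if for every $s^0_\omega,s^d_\omega\in A^\omega$ there is a time $T$ such that $s^d_\omega$ is reachable from $s^0_\omega$ at time $T$. It is regional controllable for every $n$ if this holds for regions of $n$ cells for every $n$. *)

(* Defs.v *)
From mathcomp Require Import all_boot all_order all_algebra.
From mathcomp Require Import all_classical all_reals.

Set Implicit Arguments.
Unset Strict Implicit.
Unset Printing Implicit Defensive.

Import Order.TTheory GRing.Theory Num.Theory.
Local Open Scope ring_scope.

Definition config (A : finType) : Type := int -> A.

(* The cylinder metric 2 ^ - min {|i| : s_i <> e_i}. *)

Definition mismatch (A : finType) (s e : config A) : pred nat :=
  fun k => `[< exists2 i : int, `|i|%N = k & s i <> e i >].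

Lemma mismatch_ex (A : finType) (s e : config A) :
  s <> e -> exists k : nat, mismatch s e k.
Proof.
move=> nse; have [i si] : exists i, s i <> e i.
  by apply/existsNP => se; apply: nse; apply/funext.
by exists `|i|%N; apply/asboolP; exists i.
Qed.

Definition config_dist (R : realType) (A : finType) (s e : config A) : R :=
  match pselect (s = e) with
  | left _ => 0
  | right nse => 2 ^- ex_minn (mismatch_ex nse)
  end.

(* Only the values c 0, ..., c n matter. *)
Definition eps_chain (R : realType) (A : finType) (F : config A -> config A)
    (eps : R) (n : nat) (x y : config A) : Prop :=
  (0 < n)%N /\
  exists c : nat -> config A,
    [/\ c 0%N = x, c n = y &
        forall i : nat, (i < n)%N -> config_dist R (F (c i)) (c i.+1) < eps].

Definition chain_transitive (R : realType) (A : finType)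
    (F : config A -> config A) : Prop :=
  forall (x y : config A) (eps : R), 0 < eps ->
    exists n : nat, eps_chain F eps n x y.

Definition chain_mixing (R : realType) (A : finType)
    (F : config A -> config A) : Prop :=
  forall (x y : config A) (eps : R), 0 < eps ->
    exists2 N : nat, (0 < N)%N &
      forall n : nat, (N <= n)%N -> eps_chain F eps n x y.

(* The local rule reads its neighbourhood from left to right: entry j of the
   tuple is the cell at offset j - r. *)

Definition ca_map (A : finType) (r : nat)
    (f : (2 * r + 1).-tuple A -> A) (s : config A) : config A :=
  fun i : int => f [tuple s (i - r%:Z + (j : nat)%:Z) | j < 2 * r + 1].

Lemma window_ltn (n r : nat) (i : 'I_n) (j : 'I_(2 * r + 1)) :
  (i + j < r + (n + r))%N.
Proof.
rewrite addnCA addnn -mul2n -addSn leq_add //.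
by case: j => j /=; rewrite addn1 ltnS.
Qed.

(* The length n + 2r is written r + (n + r) so that it is the length of
   x ++ w ++ y; output cell i is centred at position r + i of z, so its
   neighbourhood starts at position i. *)
Definition ca_word (A : finType) (r : nat) (f : (2 * r + 1).-tuple A -> A)
    (n : nat) (z : (r + (n + r)).-tuple A) : n.-tuple A :=
  [tuple f [tuple tnth z (Ordinal (window_ltn i j)) | j < 2 * r + 1] | i < n].

Definition reachable1 (A : finType) (r : nat) (f : (2 * r + 1).-tuple A -> A)
    (n : nat) (w u : n.-tuple A) : Prop :=
  exists x y : r.-tuple A, ca_word f [tuple of x ++ (w ++ y)] = u.

Definition reachable (A : finType) (r : nat) (f : (2 * r + 1).-tuple A -> A)
    (n : nat) (T : nat) (w u : n.-tuple A) : Prop :=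
  exists p : nat -> n.-tuple A,
    [/\ p 0%N = w, p T = u &
        forall i : nat, (i < T)%N -> reachable1 f (p i) (p i.+1)].

Definition regional_controllable (A : finType) (r : nat)
    (f : (2 * r + 1).-tuple A -> A) (n : nat) : Prop :=
  forall s0 sd : n.-tuple A, exists T : nat, reachable f T s0 sd.

(* Main.v *)
Require Import Defs.
From mathcomp Require Import all_boot all_order all_algebra.
From mathcomp Require Import all_classical all_reals.
From mathcomp Require Import zify.

(** Agreement up to 2^-m is agreement on the window [-m, m], so an eps-chain is
    the same thing as a path of words in that window, the cells outside acting
    as the boundary control; only the first step is forced, and the path starts
    at the image of the first configuration. This gives the statement about
    chain transitivity. For mixing, arbitrarily long paths between constant
    words are needed. If some constant word is fixed this is clear. Otherwise
    the two constant words 0^n and 1^n are swapped; a path of length T from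
    0^2n to 0^n 1^n restricts on its halves to paths of length T from 0^n to
    0^n and from 0^n to 1^n, so that 0^n returns to itself in T and in T + 1
    steps, and in 2 steps, hence in every number of steps from T on. *)

Set Implicit Arguments.
Unset Strict Implicit.
Unset Printing Implicit Defensive.

Import Order.TTheory GRing.Theory Num.Theory.
Local Open Scope ring_scope.

(** * Windows of configurations and words *)

Definition window (A : finType) (c : config A) (z : int) (n : nat) : n.-tuple A :=
  [tuple c (z + (i : nat)%:Z) | i < n].

(** The absolute value turns an integer offset into a list index, so cells left of [z] mirror the
    word and cells far away hold [a]. *)
Definition of_word (A : finType) (a : A) (n : nat) (t : n.-tuple A) (z : int) :
    config A :=
  fun i => nth a t `|(i - z)%R|%N.

Lemma eq_window (A : finType) (c d : config A) (z z' : int) (n : nat) :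
  (forall i : nat, (i < n)%N -> c (z + i%:Z) = d (z' + i%:Z)) ->
  window c z n = window d z' n.
Proof. by move=> cd; apply: eq_from_tnth => i; rewrite !tnth_mktuple cd. Qed.

Lemma window_inj (A : finType) (c d : config A) (z z' : int) (n i : nat) :
  window c z n = window d z' n -> (i < n)%N -> c (z + i%:Z) = d (z' + i%:Z).
Proof.
move=> cd lt_in; have := congr1 (fun t => tnth t (Ordinal lt_in)) cd.
by rewrite !tnth_mktuple.
Qed.

Lemma window_of_word (A : finType) (a : A) (n : nat) (t : n.-tuple A) (z : int) :
  window (of_word a t z) z n = t.
Proof.
apply: eq_from_tnth => i; rewrite tnth_mktuple /of_word (tnth_nth a).
by congr nth; lia.
Qed.

Lemma window_cat (A : finType) (c : config A) (z : int) (m n : nat) :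
  window c z (m + n) = [tuple of window c z m ++ window c (z + m%:Z) n].
Proof.
apply: eq_from_tnth => i; rewrite tnth_mktuple (tnth_nth (c 0)) /= nth_cat.
rewrite size_map size_enum_ord; case: ltnP => im.
  by rewrite -[nth _ _ i](tnth_nth _ (window c z m) (Ordinal im)) tnth_mktuple.
have ltn : (i - m < n)%N by have := ltn_ord i; lia.
rewrite -[nth _ _ (i - m)](tnth_nth _ (window c (z + m%:Z) n) (Ordinal ltn)).
by rewrite tnth_mktuple /=; congr c; lia.
Qed.

(** * Paths of words and the configurations realising them *)

Section LocalRule.

Variables (A : finType) (r : nat) (f : (2 * r + 1).-tuple A -> A).

Lemma ca_word_window (c : config A) (z : int) (n : nat) :
  ca_word f (window c (z - r%:Z) (r + (n + r))) = window (ca_map f c) z n.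
Proof.
apply: eq_from_tnth => i; rewrite !tnth_mktuple /ca_map; congr f.
by apply: eq_from_tnth => j; rewrite !tnth_mktuple /=; congr c; lia.
Qed.

(** The [r] cells of [c] on either side of the window serve as boundary control. *)
Lemma reachable1_window (c : config A) (z : int) (n : nat) :
  reachable1 f (window c z n) (window (ca_map f c) z n).
Proof.
exists (window c (z - r%:Z) r), (window c (z + n%:Z) r).
by rewrite -ca_word_window !window_cat subrK.
Qed.

(** Conversely, a step with control [x], [y] is realised by writing the word [x ++ w ++ y] from cell
    [z - r] on. *)
Lemma reachable1_config (a : A) (z : int) (n : nat) (w u : n.-tuple A) :
  reachable1 f w u ->
  exists2 c : config A, window c z n = w & window (ca_map f c) z n = u.
Proof.
move=> [x [y <-]]; set t := [tuple of _].
exists (of_word a t (z - r%:Z)); last by rewrite -ca_word_window window_of_word.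
apply: eq_from_tnth => i; rewrite tnth_mktuple /of_word /t /= nth_cat.
rewrite size_tuple nth_cat size_tuple.
have -> : `|(z + (i : nat)%:Z - (z - r%:Z))%R|%N = (r + i)%N by lia.
by rewrite ltnNge leq_addr /= addKn ltn_ord (tnth_nth a).
Qed.

Lemma reachable_refl (n : nat) (w : n.-tuple A) : reachable f 0 w w.
Proof. by exists (fun=> w). Qed.

Lemma reachable1_reachable (n : nat) (w u : n.-tuple A) :
  reachable1 f w u -> reachable f 1 w u.
Proof.
by move=> wu; exists (fun i => if i is 0%N then w else u); split=> // -[].
Qed.

Lemma reachable_trans (n S T : nat) (w v u : n.-tuple A) :
  reachable f S w v -> reachable f T v u -> reachable f (S + T) w u.
Proof.
move=> [p [p0 pS pstep]] [q [q0 qT qstep]].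
exists (fun i => if (i < S)%N then p i else q (i - S)%N); split.
- by case: ltnP => //; rewrite leqn0 => /eqP S0; rewrite S0 q0 -pS S0.
- by rewrite ltnNge leq_addr /= addKn.
move=> i lt_i; case: (ltnP i S) => iS; last first.
  rewrite ltnNge leqW //= subSn //; apply: qstep; lia.
case: ltnP => iS'; first exact: pstep.
(* At the junction, [q 0] is also the endpoint of [p], so the last step of [p] applies. *)
have eS : S = i.+1 by lia.
by rewrite -eS subnn q0 -pS eS; apply: pstep.
Qed.

Lemma reachable_muln (n T k : nat) (w : n.-tuple A) :
  reachable f T w w -> reachable f (k * T) w w.
Proof.
move=> ww; elim: k => [|k IHk]; first exact: reachable_refl.
by rewrite mulSn; apply: reachable_trans IHk.
Qed.

(** A path restricts to any smaller window: at each step, the surrounding cells of a configuration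
    realising the larger step control the smaller one. *)
Lemma reachable_subwindow (c d : config A) (z : int) (k n N T : nat) :
  (k + n <= N)%N -> reachable f T (window c z N) (window d z N) ->
  reachable f T (window c (z + k%:Z) n) (window d (z + k%:Z) n).
Proof.
move=> knN [p [p0 pT pstep]].
have sub (e e' : config A) : window e z N = window e' z N ->
    window e (z + k%:Z) n = window e' (z + k%:Z) n.
  move=> ee'; apply: eq_window => i lt_in; rewrite -addrA -PoszD.
  by apply: (window_inj ee'); lia.
pose q i := of_word (c 0) (p i) z.
have qE i : window (q i) z N = p i by exact: window_of_word.
exists (fun i => window (q i) (z + k%:Z) n); split.
- by apply: sub; rewrite qE.
- by apply: sub; rewrite qE.
move=> i lt_iT; have [e eE Fe] := reachable1_config (c 0) z (pstep i lt_iT).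
rewrite (sub (q i) e) ?qE // (sub (q i.+1) (ca_map f e)) ?qE //.
exact: reachable1_window.
Qed.

End LocalRule.

(** * Chains as paths of words *)

Section Chains.

Variables (R : realType) (A : finType).

(** If the first mismatch is at distance [k], the inequality says [m < k]. Being strict, it includes
    the cells at distance exactly [m], whence windows of [2 * m + 1] cells. *)
Lemma config_dist_lt (s e : config A) (m : nat) :
  config_dist R s e < 2 ^- m <-> forall i : int, (`|i| <= m)%N -> s i = e i.
Proof.
rewrite /config_dist; case: pselect => [->|nse].
  by split=> // _; rewrite invr_gt0 exprn_gt0.
case: ex_minnP => k /asboolP[j jk sj] kmin.
rewrite ltf_pV2 ?posrE ?exprn_gt0 // ltr_eXn2l ?ltr1n //; split=> [mk i im|se].
  apply: contrapT => si; have : (k <= `|i|)%N by apply: kmin; apply/asboolP; exists i.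
  lia.
by rewrite ltnNge; apply/negP => km; apply: sj; apply: se; rewrite jk.
Qed.

Lemma config_dist_window (s e : config A) (m : nat) :
  config_dist R s e < 2 ^- m <->
  window s (- m%:Z) (2 * m + 1) = window e (- m%:Z) (2 * m + 1).
Proof.
rewrite config_dist_lt; split=> [se|se i im].
  by apply: eq_window => i lt_i; apply: se; lia.
have -> : i = - m%:Z + `|(i + m%:Z)%R|%N%:Z by lia.
by apply: (window_inj se); lia.
Qed.

Lemma eps_chain_le (F : config A -> config A) (eps eps' : R) (n : nat)
    (x y : config A) :
  eps <= eps' -> eps_chain F eps n x y -> eps_chain F eps' n x y.
Proof.
move=> le_eps [n0 [c [c0 cn cstep]]]; split=> //; exists c; split=> // i lt_in.
exact: lt_le_trans (cstep i lt_in) le_eps.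
Qed.

Lemma eps_chain_reachable (r : nat) (f : (2 * r + 1).-tuple A -> A) (m n : nat)
    (x y : config A) :
  eps_chain (ca_map f) (2 ^- m : R) n x y ->
  reachable f n (window x (- m%:Z) (2 * m + 1)) (window y (- m%:Z) (2 * m + 1)).
Proof.
move=> [_ [c [<- <- cstep]]].
exists (fun i => window (c i) (- m%:Z) (2 * m + 1)); split=> // i lt_in.
by have /config_dist_window <- := cstep i lt_in; apply: reachable1_window.
Qed.

Lemma reachable_eps_chain (r : nat) (f : (2 * r + 1).-tuple A -> A) (m n : nat)
    (x y : config A) :
  reachable f n (window (ca_map f x) (- m%:Z) (2 * m + 1))
    (window y (- m%:Z) (2 * m + 1)) ->
  eps_chain (ca_map f) (2 ^- m : R) n.+1 x y.
Proof.
move=> [p [p0 pn pstep]]; split=> //.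
have /choice[c cP] i : exists c : config A, (i < n)%N ->
    window c (- m%:Z) (2 * m + 1) = p i /\
    window (ca_map f c) (- m%:Z) (2 * m + 1) = p i.+1.
  case: (ltnP i n) => [lt_in|_]; last by exists x.
  by have [c cE Fc] := reachable1_config (x 0) (- m%:Z) (pstep i lt_in); exists c.
(* The chain is [x], [c 0], ..., [c (n - 1)], [y]: its entry [j.+1] carries the word [p j], and the
   extra first step goes from [x] to a configuration carrying [p 0], the window of the image of
   [x]. *)
exists (fun i => if i is j.+1 then (if (j < n)%N then c j else y) else x).
split=> //; first by rewrite ltnn.
have tailE j : (j <= n)%N ->
    window (if (j < n)%N then c j else y) (- m%:Z) (2 * m + 1) = p j.
  by case: ltnP => [/cP[]//|nj jn]; rewrite -pn; congr p; lia.
move=> [|i] lt_in; apply/config_dist_window; rewrite tailE //.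
by have lt_in' : (i < n)%N by []; rewrite lt_in'; have [] := cP i lt_in'.
Qed.

Lemma exp2V_lt (eps : R) : 0 < eps -> exists m : nat, 2 ^- m < eps.
Proof.
move=> eps0; exists (Num.bound eps^-1).
rewrite -[ltRHS]invrK ltf_pV2 ?posrE ?invr_gt0 ?exprn_gt0 //.
apply: (lt_trans (archi_boundP _)); first by rewrite invr_ge0 ltW.
by rewrite -natrX ltr_nat ltn_expl.
Qed.

Lemma chain_mixing_transitive (F : config A -> config A) :
  chain_mixing R F -> chain_transitive R F.
Proof.
move=> mixF x y eps eps0.
by have [N _ /(_ N (leqnn N))] := mixF x y eps eps0; exists N.
Qed.

Lemma chain_transitive_controllable (a : A) (r : nat)
    (f : (2 * r + 1).-tuple A -> A) :
  chain_transitive R (ca_map f) -> forall n : nat, regional_controllable f n.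
Proof.
move=> trF n s0 sd; have eps0 : 0 < 2 ^- n :> R by rewrite invr_gt0 exprn_gt0.
have [T chT] := trF (of_word a s0 0) (of_word a sd 0) _ eps0; exists T.
(* The region, cells 0 to n - 1, starts at offset [n] in the window [-n, n]. *)
have le_n : (n + n <= 2 * n + 1)%N by lia.
have := reachable_subwindow le_n (eps_chain_reachable chT).
by rewrite addNr !window_of_word.
Qed.

End Chains.

(** * Constant words and mixing *)

Definition constant_config (A : finType) (a : A) : config A := fun=> a.

Lemma ca_map_constant (A : finType) (r : nat) (f : (2 * r + 1).-tuple A -> A) (a : A) :
  ca_map f (constant_config a) = constant_config (f [tuple a | _ < 2 * r + 1]).
Proof. by []. Qed.

Lemma reachable_constant (A : finType) (r : nat) (f : (2 * r + 1).-tuple A -> A)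
    (a : A) (n : nat) :
  reachable f 1 (window (constant_config a) 0 n)
    (window (constant_config (f [tuple a | _ < 2 * r + 1])) 0 n).
Proof.
apply: reachable1_reachable; rewrite -ca_map_constant.
exact: reachable1_window.
Qed.

(** A constant word with loops of every large length can pad a path to any prescribed large
    length. *)
Lemma constant_recurrent (r : nat) (f : (2 * r + 1).-tuple bool -> bool) (n : nat) :
  regional_controllable f (n + n) ->
  exists (a : bool) (N : nat), forall k : nat, (N <= k)%N ->
    reachable f k (window (constant_config a) 0 n) (window (constant_config a) 0 n).
Proof.
move=> ctrl.
have fixed a : f [tuple a | _ < 2 * r + 1] = a -> exists (a : bool) (N : nat),
    forall k : nat, (N <= k)%N ->
    reachable f k (window (constant_config a) 0 n) (window (constant_config a) 0 n).
  move=> fa; exists a, 0%N => k _; rewrite -[k]muln1; apply: reachable_muln.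
  by have := reachable_constant f a n; rewrite fa.
case: (boolP (f [tuple false | _ < 2 * r + 1])) => [f0|/negbTE/fixed//].
case: (boolP (f [tuple true | _ < 2 * r + 1])) => [/fixed//|/negbTE f1].
have step0 := reachable_constant f false n; rewrite f0 in step0.
have step1 := reachable_constant f true n; rewrite f1 in step1.
(* Its windows of length [n] at 0 and at [n] are the two constant words, so one path to it yields
   two paths of equal length. *)
pose half : config bool := fun i => n%:Z <= i.
have [T rT] := ctrl (window (constant_config false) 0 _) (window half 0 _).
have le0 : (0 + n <= n + n)%N by lia.
have loopT := reachable_subwindow le0 rT.
have loopT1 := reachable_subwindow (leqnn _) rT.
have halfl : window half (0 + 0) n = window (constant_config false) 0 n.
  by apply: eq_window => i lt_in; rewrite /half /constant_config; lia.
have halfr : window half (0 + n%:Z) n = window (constant_config true) 0 n.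
  by apply: eq_window => i lt_in; rewrite /half /constant_config; lia.
rewrite halfl in loopT; rewrite halfr in loopT1.
have {}loopT1 := reachable_trans loopT1 step1.
have loop2 := reachable_trans step0 step1.
exists false, T => k le_Tk.
(* The parity of [k - T] selects the loop of length [T] or [T + 1]; loops of length 2 supply the
   rest. *)
have kE : k = (T + odd (k - T) + (k - T)./2 * 2)%N by lia.
rewrite kE; apply: reachable_trans (reachable_muln _ loop2).
by case: odd; rewrite ?addn0.
Qed.

Lemma controllable_chain_mixing (R : realType) (r : nat)
    (f : (2 * r + 1).-tuple bool -> bool) :
  (forall n : nat, (1 <= n)%N -> regional_controllable f n) ->
  chain_mixing R (ca_map f).
Proof.
move=> ctrl x y eps /exp2V_lt[m lt_eps].
have ctrl_m : regional_controllable f (2 * m + 1) by apply: ctrl; lia.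
have [|a [N loopN]] := @constant_recurrent r f (2 * m + 1); first by apply: ctrl; lia.
set v := window _ _ _ in loopN.
have [S rS] := ctrl_m (window (ca_map f x) (- m%:Z) _) v.
have [T rT] := ctrl_m v (window y (- m%:Z) _).
(* Go to [v] in [S] steps, loop there for at least [N] steps, then reach [y] in [T]; the additional
   step is the forced one from [x]. *)
exists (S + N + T).+1 => // -[//|k] le_k.
apply: eps_chain_le (ltW lt_eps) _; apply: reachable_eps_chain.
have -> : k = (S + ((k - S - T) + T))%N by lia.
by apply: reachable_trans rS (reachable_trans (loopN _ _) rT); lia.
Qed.

Theorem proposition3p3 (R : realType) (r : nat) (hr : (1 <= r)%N)
    (f : (2 * r + 1).-tuple bool -> bool) :
  (chain_transitive R (ca_map f) <->
     forall n : nat, (1 <= n)%N -> regional_controllable f n) /\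
  (chain_mixing R (ca_map f) <->
     forall n : nat, (1 <= n)%N -> regional_controllable f n).
Proof.
have trans_ctrl : chain_transitive R (ca_map f) ->
    forall n : nat, (1 <= n)%N -> regional_controllable f n.
  by move=> trF n _; apply: (chain_transitive_controllable false trF).
split; split=> [|ctrl].
- exact: trans_ctrl.
- exact/chain_mixing_transitive/controllable_chain_mixing.
- by move/chain_mixing_transitive/trans_ctrl.
- exact: controllable_chain_mixing.
Qed.
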